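(* Let $R$ be a von Neumann regular ring which is right self pseudo injective, i.e. such that the right module $R_R$ is pseudo injective. Then $R$ is separative.
   Context: Rings are associative with identity. A ring $R$ is (von Neumann) regular if for every $a\in R$ there exists $b\in R$ with $a=aba$. A right module $M$ is called pseudo injective (also called auto invariant) if every monomorphism from a submodule $N$ of $M$ into $M$ can be extended to an endomorphism of $M$. A ring $R$ is separative if for any finitely generated projective right $R$-modules $M$ and $N$, the isomorphisms $M\oplus N\cong M\oplus M\cong N\oplus N$ imply $M\cong N$. *)

(* Defs.v *)
From HB Require Import structures.
From mathcomp Require Import all_boot all_algebra.

Set Implicit Arguments.
Unset Strict Implicit.
Unset Printing Implicit Defensive.

Import GRing.Theory.
Local Open Scope ring_scope.

(* Library modules are left modules, so right R-modules are taken to be left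
   modules over the converse ring R^c, where a * b stands for b * a in R; the
   right module R_R is then R^c^o, whose scaling a *: x is x * a in R.
   Rings are allowed to be trivial (1 = 0). *)
Notation rmodType R := (lmodType R^c).
Notation right_regular_module R := ((R^c)^o : rmodType R).

Definition von_neumann_regular (R : pzRingType) : Prop :=
  forall a : R, exists b : R, a = a * b * a.

Section Modules.
Variable A : pzRingType.

Definition pseudo_injective (M : lmodType A) : Prop :=
  forall (S : {pred M}) (N : subLmodType S) (f : {linear N -> M}),
    injective f -> exists g : {linear M -> M}, forall x : N, g (val x) = f x.

Definition finitely_generated (M : lmodType A) : Prop :=
  exists (n : nat) (v : 'I_n -> M),
    forall x : M, exists c : 'I_n -> A, x = \sum_(i < n) c i *: v i.

Definition projective (P : lmodType A) : Prop :=
  forall (X Y : lmodType A) (p : {linear X -> Y}) (g : {linear P -> Y}),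
    (forall y : Y, exists x : X, p x = y) ->
    exists h : {linear P -> X}, forall z : P, p (h z) = g z.

Definition mod_iso (M N : lmodType A) : Prop :=
  exists f : {linear M -> N}, bijective f.

End Modules.

Definition separative (R : pzRingType) : Prop :=
  forall M N : rmodType R,
    finitely_generated M -> projective M ->
    finitely_generated N -> projective N ->
    mod_iso (M * N)%type (M * M)%type ->
    mod_iso (M * M)%type (N * N)%type ->
    mod_iso M N.

(* Main.v *)
(* Write A for R^c, so that everything is about left A-modules.  Regularity of
   Hom(P, N) for finitely generated projective P, N gives the refinement
   property, and with it separativity reduces to cancelling a cyclic projective
   D <= A from M + D ~ N + D when D embeds in both M and N as a summand.
   Refining this isomorphism gives K + L ~ D ~ K' + L, with K in M and K' in N.
   In D = Ae, extend the isomorphism between the two copies of L to a maximal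
   partial isomorphism G, with domain and range complemented by W and W'.
   By maximality no nonzero cyclic submodules of W and W' are isomorphic; hence
   iterating an extension of the inverse of G embeds infinitely many independent
   copies of W in D.  Pseudo-injectivity turns this shift into an injective
   endomorphism of D whose cokernel An is an essential closure of W, so that
   D + An ~ D; symmetrically D + An' ~ D.  Modulo An and An' the isomorphism G
   extends to an isomorphism of D/An onto D/An', whence K ~ An + K0 and
   K' ~ An' + K0.  Both M and N absorb An and An', so M ~ N. *)
Require Import Defs.
From HB Require Import structures.
From mathcomp Require Import all_boot all_algebra.
From mathcomp Require Import boolp classical_sets.
From Stdlib Require Import Setoid Morphisms.

Set Implicit Arguments.
Unset Strict Implicit.
Unset Printing Implicit Defensive.

Import GRing.Theory.
Local Open Scope ring_scope.

Local Notation "M =~ N" := (mod_iso M N) (at level 70, no associativity).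

(** * Direct sums of modules and the refinement property *)

Section LinearMaps.
Variable A : pzRingType.
Implicit Types M N P : lmodType A.

Definition pair_fun M N P (f : M -> N) (g : M -> P) (x : M) := (f x, g x).

Section Pair.
Variables (M N P : lmodType A) (f : {linear M -> N}) (g : {linear M -> P}).

Fact pair_fun_is_linear : linear (pair_fun f g).
Proof. by move=> a x y; rewrite /pair_fun !linearP. Qed.

HB.instance Definition _ :=
  GRing.isLinear.Build A M (N * P)%type *:%R (pair_fun f g) pair_fun_is_linear.
End Pair.

Definition mul_on_right (r : A) (x : A^o) : A^o := x * r.

Fact mul_on_right_is_linear r : linear (mul_on_right r).
Proof.
move=> a x y.
exact: etrans (mulrDl _ _ _) (congr1 (+%R^~ _) (esym (mulrA _ _ _))).
Qed.

HB.instance Definition _ r :=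
  GRing.isLinear.Build A A^o A^o *:%R (mul_on_right r)
    (mul_on_right_is_linear r).

Lemma linear_regularE M (f : {linear A^o -> M}) (a : A) : f a = a *: f 1.
Proof. by rewrite -linearZ /= [a *: _]mulr1. Qed.

Lemma exists_linear M N (f : M -> N) :
  linear f -> exists g : {linear M -> N}, g =1 f.
Proof.
move=> lf; pose H := GRing.isLinear.Build A M N *:%R f lf.
pose g : {linear M -> N} := HB.pack f H.
by exists g.
Qed.

Lemma mod_isoI M N (f : {linear M -> N}) (g : {linear N -> M}) :
  cancel f g -> cancel g f -> M =~ N.
Proof. by move=> fK gK; exists f; exists g. Qed.

Lemma mod_isoE M N : M =~ N ->
  exists (f : {linear M -> N}) (g : {linear N -> M}), cancel f g /\ cancel g f.
Proof.
case=> f [g fK gK]; have [g' g'E] := exists_linear (can2_linear fK gK).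
by exists f, g'; split=> x; rewrite g'E.
Qed.

Lemma mod_iso_refl M : M =~ M.
Proof. exact: (@mod_isoI _ _ idfun idfun). Qed.

Lemma mod_iso_sym M N : M =~ N -> N =~ M.
Proof. by move=> /mod_isoE[f [g [fK gK]]]; exact: mod_isoI gK fK. Qed.

Lemma mod_iso_trans M N P : M =~ N -> N =~ P -> M =~ P.
Proof.
move=> /mod_isoE[f [g [fK gK]]] /mod_isoE[h [k [hK kK]]].
by apply: (@mod_isoI _ _ (h \o f) (g \o k)) => x /=; rewrite ?hK ?gK.
Qed.

Definition dsum M N : lmodType A := (M * N)%type.

Definition dfst M N : {linear dsum M N -> M} := @fst M N.
Definition dsnd M N : {linear dsum M N -> N} := @snd M N.
Definition dpair P M N (f : {linear P -> M}) (g : {linear P -> N}) :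
  {linear P -> dsum M N} := pair_fun f g.
Definition dcopair M N P (f : {linear M -> P}) (g : {linear N -> P}) :
  {linear dsum M N -> P} := (f \o @dfst M N) \+ (g \o @dsnd M N).
Definition dinl M N : {linear M -> dsum M N} := dpair idfun \0.
Definition dinr M N : {linear N -> dsum M N} := dpair \0 idfun.

Lemma dsum_iso M M' N N' : M =~ M' -> N =~ N' -> dsum M N =~ dsum M' N'.
Proof.
move=> /mod_isoE[f [g [fK gK]]] /mod_isoE[h [k [hK kK]]].
apply: (@mod_isoI _ _ (dpair (f \o @dfst M N) (h \o @dsnd M N))
         (dpair (g \o @dfst M' N') (k \o @dsnd M' N'))) => -[x y];
by congr pair; rewrite /= ?(fK, hK, gK, kK).
Qed.

Lemma dsumC M N : dsum M N =~ dsum N M.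
Proof.
by apply: (@mod_isoI _ _ (dpair (@dsnd M N) (@dfst M N))
  (dpair (@dsnd N M) (@dfst N M))) => -[].
Qed.

Lemma dsumA M N P : dsum M (dsum N P) =~ dsum (dsum M N) P.
Proof.
pose f1 : {linear dsum M (dsum N P) -> dsum N P} := @dsnd _ _.
pose f2 : {linear dsum (dsum M N) P -> dsum M N} := @dfst _ _.
by apply: (@mod_isoI _ _
  (dpair (dpair (@dfst _ _) (@dfst _ _ \o f1)) (@dsnd _ _ \o f1))
  (dpair (@dfst _ _ \o f2) (dpair (@dsnd _ _ \o f2) (@dsnd _ _))))
  => [[? []]|[[]]].
Qed.

End LinearMaps.

Add Parametric Relation (A : pzRingType) : (lmodType A) (@mod_iso A)
  reflexivity proved by (@mod_iso_refl A)
  symmetry proved by (@mod_iso_sym A)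
  transitivity proved by (@mod_iso_trans A)
  as mod_iso_rel.

Add Parametric Morphism (A : pzRingType) : (@dsum A)
  with signature @mod_iso A ==> @mod_iso A ==> @mod_iso A as dsum_mor.
Proof. by move=> *; exact: dsum_iso. Qed.

#[local] Hint Resolve mod_iso_refl : core.

Section Refinement.
Variable A : pzRingType.
Implicit Types M N P : lmodType A.

Lemma dsumCA M N P : dsum M (dsum N P) =~ dsum N (dsum M P).
Proof. by rewrite dsumA (dsumC M N) -dsumA. Qed.

Lemma dsumACA M N P Q :
  dsum (dsum M N) (dsum P Q) =~ dsum (dsum M P) (dsum N Q).
Proof. by rewrite -!dsumA (dsumCA N). Qed.

Definition summand M N := exists P, dsum M P =~ N.

Lemma summand_trans N M P : summand M N -> summand N P -> summand M P.
Proof. by case=> X MX [Y NY]; exists (dsum X Y); rewrite dsumA MX. Qed.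

Lemma summandDl M N : summand M (dsum M N).
Proof. by exists N. Qed.

Lemma summandDr M N : summand N (dsum M N).
Proof. by exists M; rewrite dsumC. Qed.

Lemma summand_iso M N N' : N =~ N' -> summand M N -> summand M N'.
Proof. by move=> NN' [X MX]; exists X; rewrite MX. Qed.

Section Submodule.
Variables (M : lmodType A) (S : {pred M}) (closedS : GRing.submod_closed S).

(* A copy of S indexed by its closure proof, so that the instance below can be
   declared for an arbitrary S. *)
Definition submod_pred of GRing.submod_closed S : {pred M} := S.
HB.instance Definition _ :=
  GRing.isSubmodClosed.Build A M (submod_pred closedS) closedS.

Inductive submodule := Submodule x of x \in submod_pred closedS.
Definition submodule_val u := let: Submodule x _ := u in x.
HB.instance Definition _ := [isSub for submodule_val].
HB.instance Definition _ := [Choice of submodule by <:].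
HB.instance Definition _ := [SubChoice_isSubLmodule of submodule by <:].
End Submodule.

(** The splitting object is the submodule of fixed points of [p], which is also its image. *)
Lemma split_idempotent M (p : {linear M -> M}) : (forall x, p (p x) = p x) ->
  exists (P : lmodType A) (i : {linear P -> M}) (r : {linear M -> P}),
    cancel i r /\ forall x, i (r x) = p x.
Proof.
move=> pp; pose S : {pred M} := [pred x | p x == x].
have closedS : GRing.submod_closed S.
  split=> [|a x y]; rewrite !inE ?linear0 // => /eqP px /eqP py.
  by rewrite linearP px py.
have pS x : p x \in submod_pred closedS by rewrite inE pp.
pose r x : submodule closedS := Submodule (pS x).
have lr : linear r by move=> a x y; apply: val_inj; rewrite /= !linearP.
have [r' r'E] := exists_linear lr.
exists (submodule closedS : lmodType A), val, r'; split=> x.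
  by apply: val_inj; rewrite r'E /=; apply/eqP; case: x.
by rewrite r'E.
Qed.

Lemma retract_summand M P (i : {linear P -> M}) (r : {linear M -> P}) :
  cancel i r ->
  exists (Q : lmodType A) (j : {linear Q -> M}) (s : {linear M -> Q}),
    [/\ cancel j s, forall x, j (s x) = x - i (r x) & dsum P Q =~ M].
Proof.
move=> iK; pose p : {linear M -> M} := idfun \- (i \o r).
have [x|Q [j [s [jK js]]]] := @split_idempotent M p.
  by rewrite /p /= [r (_ - _)]linearB /= iK subrr linear0 subr0.
exists Q, j, s; split => //.
have si x : s (i x) = 0.
  by apply: (can_inj jK); rewrite js linear0 /= iK subrr.
have rj x : r (j x) = 0.
  apply: (can_inj iK); rewrite linear0.
  have /eqP := js (j x); rewrite jK -subr_eq0 opprB addrC subrK /=.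
  by move/eqP.
apply: (@mod_isoI _ _ _ (dcopair i j) (dpair r s)) => [[x y]|x].
  by congr pair; rewrite /= linearD ?iK ?jK ?rj ?si ?addr0 ?add0r.
by rewrite /= js addrC subrK.
Qed.

(* Q and Q' are both isomorphic to M modulo the image of P. *)
Lemma complement_iso M P Q Q'
    (f : {linear dsum P Q -> M}) (g : {linear M -> dsum P Q})
    (f' : {linear dsum P Q' -> M}) (g' : {linear M -> dsum P Q'}) :
  cancel f g -> cancel g f -> cancel f' g' -> cancel g' f' ->
  (forall x, f (x, 0) = f' (x, 0)) -> Q =~ Q'.
Proof.
have aux R R' (h : {linear dsum P R -> M}) (k : {linear M -> dsum P R})
    (h' : {linear dsum P R' -> M}) (k' : {linear M -> dsum P R'}) :
    cancel h k -> cancel k' h' -> (forall x, h (x, 0) = h' (x, 0)) ->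
    forall y, (k (h' (0, (k' (h (0, y))).2))).2 = y.
  move=> hK k'K hh' y; case E: (k' _) => [x z] /=.
  (* [h (0, y)] is [h' (x, z)] by [E]; subtracting the common value [h' (x, 0) = h (x, 0)] leaves
     [h (- x, y)]. *)
  suff -> : h' (0, z) = h (- x, y) by rewrite hK.
  have <- : (x, z) - (x, 0) = (0, z) :> dsum P R'.
    by congr pair; rewrite /= ?subrr ?subr0.
  rewrite linearB -E k'K -hh' -linearB.
  by congr (h _); congr pair; rewrite /= ?sub0r ?subr0.
move=> fK gK f'K g'K ff'.
apply: (@mod_isoI _ _ _ (@dsnd _ _ _ \o g' \o f \o @dinr _ P Q)
                        (@dsnd _ _ _ \o g \o f' \o @dinr _ P Q')) => y /=.
  exact: aux.
exact: aux.
Qed.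

(** Von Neumann regularity of [Hom(M, N)]: [g \o f] and [f \o g] are then idempotents that split off
    the kernel and the image of [f]. *)
Definition regular_hom M N := forall f : {linear M -> N},
  exists g : {linear N -> M}, forall x, f (g (f x)) = f x.

(** [X] is the kernel of the component [be : P -> N] of the isomorphism, [Y] a complement of [X] in
    [P], and [T] a complement of the image of [be] in [N]. The other component [al] embeds [X] in
    [M], with complement [Z]. Both [Q] and [Z + T] then complement [P] in [M + N]. *)
Lemma refinement P Q M N : regular_hom P N -> dsum P Q =~ dsum M N ->
  exists X Y Z T, [/\ P =~ dsum X Y, Q =~ dsum Z T,
                      M =~ dsum X Z & N =~ dsum Y T].
Proof.
move=> reg /mod_isoE[f [g [fK gK]]].
pose al : {linear P -> M} := @dfst _ _ _ \o f \o @dinl _ P Q.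
pose be : {linear P -> N} := @dsnd _ _ _ \o f \o @dinl _ P Q.
have fE x : f (x, 0) = (al x, be x) by rewrite /al /be /=; case: (f _).
clearbody al be.
have [q beq] := reg be.
have [x|Y [j [t [jK jt]]]] := @split_idempotent P (q \o be).
  by rewrite /= beq.
have [X [i1 [r1 [i1K i1r PE]]]] := retract_summand jK.
have bejK : cancel (be \o j) (t \o q).
  by move=> x; rewrite /= -[q _]/((q \o be) (j x)) -jt !jK.
have [T [j2 [s2 [j2K j2s NE]]]] := retract_summand bejK.
(* On the kernel of [be] the isomorphism takes values in [M], so the [P]-component [ga] of its
   inverse undoes [al] there. *)
pose ga : {linear M -> P} := @dfst _ _ _ \o g \o @dinl _ M N.
have bei1 x : be (i1 x) = 0.
  by rewrite -[in LHS](i1K x) i1r jt linearB /= beq subrr.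
have gaal u : be u = 0 -> ga (al u) = u.
  by move=> bu; rewrite /ga /= /dpair /pair_fun /= -bu -fE fK.
clearbody ga.
have ali1K : cancel (al \o i1) (r1 \o ga).
  by move=> x /=; rewrite gaal.
have [Z [j3 [s3 [j3K j3s ME]]]] := retract_summand ali1K.
have i1E u : i1 (r1 u) = u - q (be u) by rewrite i1r jt.
have j2E v : j2 (s2 v) = v - be (q v) by rewrite j2s /= jt /= beq.
have j3E v : j3 (s3 v) = v - al (i1 (r1 (ga v))) := j3s v.
clear j3s j2s i1r.
have s2be u : s2 (be u) = 0.
  by apply: (can_inj j2K); rewrite linear0 j2E beq subrr.
have beqj2 z : be (q (j2 z)) = 0.
  by have := j2E (j2 z); rewrite j2K -{1}[j2 z]subr0 => /addrI /oppr_inj.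
have r1gaj3 y : r1 (ga (j3 y)) = 0.
  rewrite -(ali1K (r1 _)) /=; have := j3E (j3 y).
  by rewrite j3K -{1}[j3 y]subr0 => /addrI /oppr_inj <-; rewrite !linear0.
have s3al u : be u = 0 -> s3 (al u) = 0.
  move=> bu; apply: (can_inj j3K); rewrite linear0 j3E gaal // i1E bu.
  by rewrite linear0 subr0 subrr.
exists X, Y, Z, T; split; [ | | exact: mod_iso_sym ME | exact: mod_iso_sym NE].
  by rewrite -PE dsumC.
(* [h] keeps [f] on [P] and puts [Z + T] in place of [Q]. Its inverse [k] first lifts the
   [N]-coordinate to [P] by [q]; [de] is what then remains in [M]. *)
pose h := dcopair (f \o @dinl _ P Q)
    (dpair (j3 \o @dfst _ Z T) (j2 \o @dsnd _ Z T)).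
pose de : {linear dsum M N -> M} := @dfst _ M N \- (al \o q \o @dsnd _ M N).
pose k := dpair ((q \o @dsnd _ M N) \+ (i1 \o r1 \o ga \o de))
            (dpair (s3 \o de) (s2 \o @dsnd _ M N)).
have hE x y z : h (x, (y, z)) = (al x + j3 y, be x + j2 z).
  by rewrite /h /= -[dinl _ _ _]/(x, 0) fE.
have kE x y : k (x, y) =
    (q y + i1 (r1 (ga (x - al (q y)))), (s3 (x - al (q y)), s2 y)) by [].
apply: (complement_iso fK gK (f' := h) (g' := k)) => [[x [y z]]|[x y]|x].
- rewrite hE kE; set u := x - (q (be x + j2 z)).
  have bu : be u = 0.
    rewrite /u linearB [q _]linearD [be (_ + _)]linearD /= beq beqj2.
    by rewrite addr0 subrr.
  have -> : al x + j3 y - al (q (be x + j2 z)) = al u + j3 y.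
    by rewrite /u linearB /= addrAC.
  have -> : r1 (ga (al u + j3 y)) = r1 u.
    by rewrite [ga _]linearD [r1 _]linearD /= gaal // r1gaj3 addr0.
  rewrite [s3 _]linearD [s2 _]linearD /= s3al // s2be j2K j3K !add0r i1E bu.
  by rewrite linear0 subr0 /u addrC subrK.
- rewrite kE hE; congr pair.
    by rewrite j3E linearD addrACA subrr addr0 addrC subrK.
  by rewrite j2E linearD /= bei1 addr0 addrC subrK.
- by rewrite fE hE !linear0 !addr0.
Qed.

End Refinement.

(** * Finitely generated projective modules over a regular ring *)

Section RegularHom.
Variable A : pzRingType.
Implicit Types M N P : lmodType A.

Lemma dsum_eta M N P (h : {linear dsum M N -> P}) x :
  h x = h (@dinl _ M N x.1) + h (@dinr _ M N x.2).
Proof.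
rewrite -linearD; congr (h _); case: x => x y.
by congr pair; rewrite /= ?addr0 ?add0r.
Qed.

(** Elimination: once [f1] has a generalized inverse, [f2] is treated modulo the image of [f1],
    which [p] kills. *)
Lemma regular_hom_dsuml M M' N :
  regular_hom M N -> regular_hom M' N -> regular_hom (dsum M M') N.
Proof.
move=> regM regM' f.
pose f1 : {linear M -> N} := f \o @dinl _ M M'.
pose f2 : {linear M' -> N} := f \o @dinr _ M M'.
have fE x : f x = f1 x.1 + f2 x.2 by exact: dsum_eta.
clearbody f1 f2.
have [g1 fg1] := regM f1.
pose p : {linear N -> N} := idfun \- (f1 \o g1).
have pE x : p x = x - f1 (g1 x) by [].
have pf1 x : p (f1 x) = 0 by rewrite pE fg1 subrr.
clearbody p.
have [g2 fg2] := regM' (p \o f2).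
pose h : {linear N -> M'} := g2 \o p.
have hf1 x : h (f1 x) = 0 by rewrite /h /= pf1 linear0.
have hf2 x : p (f2 (h (f2 x))) = p (f2 x) by apply: fg2.
clearbody h.
exists (dpair (g1 \o (idfun \- (f2 \o h))) h) => x.
rewrite !fE /=; set y := f1 x.1 + f2 x.2.
have hE : p (f2 (h y)) = p (f2 x.2).
  by rewrite /y [h _]linearD /= hf1 add0r hf2.
have : p y = p (f2 x.2) by rewrite /y linearD /= pf1 add0r.
rewrite -hE !pE => E; rewrite !linearB /= -addrA.
by rewrite [- _ + _]addrC -E addrC subrK.
Qed.

(** Dually, [f2] is treated on the kernel of [f1], where [p] takes its values. *)
Lemma regular_hom_dsumr M N N' :
  regular_hom M N -> regular_hom M N' -> regular_hom M (dsum N N').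
Proof.
move=> regN regN' f.
pose f1 : {linear M -> N} := @dfst _ N N' \o f.
pose f2 : {linear M -> N'} := @dsnd _ N N' \o f.
have fE x : f x = (f1 x, f2 x) by rewrite /f1 /f2 /=; case: (f x).
clearbody f1 f2.
have [g1 fg1] := regN f1.
pose p : {linear M -> M} := idfun \- (g1 \o f1).
have pE x : p x = x - g1 (f1 x) by [].
have f1p x : f1 (p x) = 0 by rewrite pE linearB /= fg1 subrr.
clearbody p.
have [g2 fg2] := regN' (f2 \o p).
exists (dcopair ((idfun \- (p \o g2 \o f2)) \o g1) (p \o g2)) => x.
rewrite !fE; congr pair; rewrite /= linearD linearB /=.
  by rewrite !f1p subr0 addr0 fg1.
have := fg2 x; rewrite /= [p x]pE; move: (g1 _) => w.
rewrite !linearB /= => /eqP; rewrite subr_eq => /eqP ->.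
by rewrite addrACA addNr addr0 addrC subrK.
Qed.

Lemma regular_hom_summandl M N P :
  summand M N -> regular_hom N P -> regular_hom M P.
Proof.
case=> X /mod_isoE[i [r [iK rK]]] regN f.
have [g fg] := regN (f \o @dfst _ M X \o r).
exists (@dfst _ M X \o r \o g) => x.
by have := fg (i (x, 0)); rewrite /= iK.
Qed.

Lemma regular_hom_summandr M N P :
  summand N P -> regular_hom M P -> regular_hom M N.
Proof.
case=> X /mod_isoE[i [r [iK rK]]] regP f.
have [g fg] := regP (i \o @dinl _ N X \o f).
exists (g \o i \o @dinl _ N X) => x /=.
by have /(can_inj iK) [] := fg x.
Qed.

Hypothesis regA : von_neumann_regular A.

Fixpoint pow n : lmodType A :=
  if n is m.+1 then dsum A^o (pow m) else 'rV[A]_0.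

(** Finite generation and projectivity enter the argument only in this form, through
    [fg_projectiveP]. *)
Definition fg_projective M := exists n, summand M (pow n).

Lemma regular_hom_powr n : regular_hom A^o (pow n).
Proof.
elim: n => [|n IHn] /=.
  by move=> f; exists \0 => x; rewrite [LHS]thinmx0 [RHS]thinmx0.
apply: regular_hom_dsumr => // f; have [b fb] := regA (f 1).
exists (mul_on_right b) => x.
have fE a : f a = a * f 1 := linear_regularE f a.
by rewrite [LHS]fE /= /mul_on_right [f x]fE -!mulrA [f 1 * _]mulrA -fb.
Qed.

Lemma regular_hom_pow m n : regular_hom (pow m) (pow n).
Proof.
elim: m => [|m IHm] /=; last exact: regular_hom_dsuml (@regular_hom_powr n) IHm.
by move=> f; exists \0 => x; rewrite [x]thinmx0 !linear0.
Qed.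

Lemma regular_hom_fg M N :
  fg_projective M -> fg_projective N -> regular_hom M N.
Proof.
move=> [m mM] [n nN]; apply: regular_hom_summandl mM _.
exact: regular_hom_summandr nN (@regular_hom_pow _ _).
Qed.

Lemma fg_projective_summand M N :
  summand M N -> fg_projective N -> fg_projective M.
Proof. by move=> MN [n Nn]; exists n; exact: summand_trans MN Nn. Qed.

Lemma pow_add m n : dsum (pow m) (pow n) =~ pow (m + n).
Proof.
elim: m => [|m IHm] /=; last by rewrite -IHm dsumA.
apply: (@mod_isoI _ _ _ (@dsnd _ 'rV[A]_0 _) (@dinr _ 'rV[A]_0 _)) => //.
by case=> x y; congr pair; rewrite [x]thinmx0.
Qed.

Lemma fg_projective_dsum M N :
  fg_projective M -> fg_projective N -> fg_projective (dsum M N).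
Proof.
move=> [m [X mX]] [n [Y nY]]; exists (m + n)%N, (dsum X Y).
by rewrite dsumACA mX nY pow_add.
Qed.

Lemma pow_span M n (v : 'I_n -> M) : exists f : {linear pow n -> M},
  forall c : 'I_n -> A, exists x, f x = \sum_(i < n) c i *: v i.
Proof.
elim: n v => [|n IHn] v.
  by exists \0 => c; exists 0; rewrite big_ord0.
have [f fP] := IHn (v \o lift ord0).
have [g gE] : exists g : {linear A^o -> M},
    g =1 (fun a : A^o => (a : A) *: v ord0).
  apply: exists_linear => a x y; rewrite scalerDl.
  by rewrite [in RHS]scalerA.
exists (dcopair g f) => c; have [x fx] := fP (c \o lift ord0).
by exists (c ord0, x); rewrite /= gE fx big_ord_recl.
Qed.

Lemma fg_projectiveP M :
  finitely_generated M -> projective M -> fg_projective M.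
Proof.
move=> [n [v vP]] projM; have [f fP] := pow_span v.
have [|h hK] := projM _ _ f (idfun : {linear M -> M}).
  by move=> y; have [c ->] := vP y; have [x <-] := fP c; exists x.
have [Q [_ [_ [_ _ MQ]]]] := retract_summand (i := h) (r := f) hK.
by exists n, Q.
Qed.

(** Two complements of copies of [L] in [D] agree up to summands that [D] absorbs. This is all that
    cancellation needs from pseudo-injectivity. *)
Definition absorption := forall D K K' L,
  summand D A^o -> dsum K L =~ D -> dsum K' L =~ D ->
  exists K0 K1 K1', [/\ K =~ dsum K0 K1, K' =~ dsum K0 K1',
                        dsum D K1 =~ D & dsum D K1' =~ D].

(** * Cancellation and separativity from absorption *)

Hypothesis absorbA : absorption.

Lemma cyclic_cancel D M N : summand D A^o ->
  fg_projective M -> summand D M -> summand D N ->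
  dsum M D =~ dsum N D -> M =~ N.
Proof.
move=> DA fgM DM DN MD.
have fgD := fg_projective_summand DM fgM.
have [X [K [K' [L [MX DK' NX DK]]]]] := refinement (regular_hom_fg fgM fgD) MD.
have [K0 [K1 [K1' [KK K'K DK1 DK1']]]] :=
  absorbA DA (mod_iso_sym DK) (mod_iso_sym DK').
have absorb P Q : summand D P -> dsum D Q =~ D -> dsum P Q =~ P.
  by case=> Y <- DQ; rewrite -dsumA (dsumC Y) dsumA DQ.
(* After [M] absorbs [K1'] and [N] absorbs [K1], both sides are [X + K0 + K1 + K1']. *)
rewrite -(absorb _ _ DM DK1') -(absorb _ _ DN DK1) MX NX KK K'K.
by rewrite -!dsumA (dsumC K1).
Qed.

(** Induction on the rank of a free module containing [D]: refining [A + A^n ~ D + X] writes [D] as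
    [Y + D'], with [Y] cyclic and [D'] a summand of [A^n]. First [D'] is cancelled by induction,
    then [Y] by [cyclic_cancel]. *)
Lemma fg_cancel D M N : fg_projective D ->
  fg_projective M -> fg_projective N -> summand D M -> summand D N ->
  dsum M D =~ dsum N D -> M =~ N.
Proof.
case=> n; elim: n D M N => [|n IHn] D M N [X DX] fgM fgN DM DN MD.
  have D0 (x : D) : x = 0.
    have [f [g [fK _]]] := mod_isoE DX.
    have /(congr1 fst) // : (x, 0) = 0 :> dsum D X.
    by apply: (can_inj fK); rewrite [LHS]thinmx0 [RHS]thinmx0.
  suff add0 P : dsum P D =~ P by rewrite -(add0 M) -(add0 N).
  apply: (@mod_isoI _ _ _ (@dfst _ P D) (@dinl _ P D)) => //.
  by case=> x y; congr pair; rewrite [y]D0.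
have regAX : regular_hom A^o X.
  apply: regular_hom_summandr (@regular_hom_powr n.+1).
  exact: summand_iso DX (summandDr _ _).
have [Y [Z [D' [T [AY nD' DE _]]]]] :=
  refinement regAX (mod_iso_sym DX : dsum A^o (pow n) =~ _).
have YD : summand Y D by apply: summand_iso (mod_iso_sym DE) (summandDl _ _).
have D'D : summand D' D by apply: summand_iso (mod_iso_sym DE) (summandDr _ _).
have fgD := fg_projective_summand DM fgM.
have fgY := fg_projective_summand YD fgD.
have YA : summand Y A^o by exact: summand_iso (mod_iso_sym AY) (summandDl _ _).
apply: (cyclic_cancel YA) => //; try exact: summand_trans YD _.
have le P : summand D P -> summand D' (dsum P Y).
  by move=> DP; exact: summand_trans D'D (summand_trans DP (summandDl _ _)).
apply: (IHn D'); try exact: le; try exact: fg_projective_dsum.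
- by apply: summand_iso (mod_iso_sym nD') (summandDl _ _).
- by rewrite -!dsumA -DE.
Qed.

(** Refining [M + M ~ N + N] gives [M ~ P + Q] with [P] and [Q] summands of both [M] and [N]. As
    [M + M ~ N + M], cancelling first [Q] and then [P] from the last [M] is legitimate. *)
Lemma separative_of_absorption M N :
  fg_projective M -> fg_projective N ->
  dsum M N =~ dsum M M -> dsum M M =~ dsum N N -> M =~ N.
Proof.
move=> fgM fgN MN MM.
have [P [Q [S [T [MPQ MST NPS NQT]]]]] :=
  refinement (regular_hom_fg fgM fgN) MM.
have PM : summand P M by apply: summand_iso (mod_iso_sym MPQ) (summandDl _ _).
have QM : summand Q M by apply: summand_iso (mod_iso_sym MPQ) (summandDr _ _).
have PN : summand P N by apply: summand_iso (mod_iso_sym NPS) (summandDl _ _).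
have QN : summand Q N by apply: summand_iso (mod_iso_sym NQT) (summandDl _ _).
have fgP := fg_projective_summand PM fgM.
have fgQ := fg_projective_summand QM fgM.
apply: (fg_cancel fgP) => //.
apply: (fg_cancel fgQ); try exact: fg_projective_dsum.
- exact: summand_trans QM (summandDl _ _).
- exact: summand_trans QN (summandDl _ _).
- by rewrite -!dsumA -MPQ -MN dsumC.
Qed.

End RegularHom.

(** * Partial isomorphisms between left ideals *)

Section PartialIso.
Variable A : pzRingType.
Implicit Types (G : set (A * A)) (I J : set A).

Definition left_ideal I :=
  I 0 /\ forall a x y, I x -> I y -> I (a * x + y).

Lemma left_idealD I x y : left_ideal I -> I x -> I y -> I (x + y).
Proof. by case=> _ clI Ix Iy; have := clI 1 x y Ix Iy; rewrite mul1r. Qed.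

Lemma left_idealM I a x : left_ideal I -> I x -> I (a * x).
Proof. by case=> I0 clI Ix; have := clI a x 0 Ix I0; rewrite addr0. Qed.

Lemma left_idealN I x : left_ideal I -> I x -> I (- x).
Proof. by rewrite -mulN1r; exact: left_idealM. Qed.

Lemma left_idealB I x y : left_ideal I -> I x -> I y -> I (x - y).
Proof. by move=> iI Ix Iy; apply: left_idealD => //; exact: left_idealN. Qed.

(* The graph of an isomorphism between two left ideals. *)
Definition partial_iso G :=
  [/\ G (0, 0),
      forall a x y x' y', G (x, y) -> G (x', y') -> G (a * x + x', a * y + y'),
      forall y, G (0, y) -> y = 0 & forall x, G (x, 0) -> x = 0].

Hypothesis injA : pseudo_injective A^o.

(** [G] is the graph of a monomorphism from a submodule of [A^o]; its extension to an endomorphism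
    of [A^o] is right multiplication by the image of 1. Pseudo-injectivity is used through this
    lemma alone. *)
Lemma partial_iso_mulr G : partial_iso G ->
  exists r, forall x y, G (x, y) -> y = x * r.
Proof.
case=> G00 clG G0l G0r.
pose S : {pred A^o} := fun x => `[< exists y, G (x, y) >].
have closedS : GRing.submod_closed S.
  split=> [|a x y]; first by apply/asboolP; exists 0.
  move=> /asboolP[x' Gx] /asboolP[y' Gy].
  by apply/asboolP; exists (a * x' + y'); exact: clG.
have GS (u : submodule closedS) : exists y, G (val u, y).
  by apply/asboolP; case: u.
have Gfun x y y' : G (x, y) -> G (x, y') -> y = y'.
  move=> Gy Gy'; apply/esym/eqP; rewrite -subr_eq0 addrC -mulN1r; apply/eqP.
  by apply: G0l; rewrite -(addNr x) -[- x]mulN1r; exact: clG.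
pose f u : A^o := projT1 (cid (GS u)).
have fG u : G (val u, f u) by rewrite /f; case: cid.
have lf : linear f.
  move=> a u v; apply: (Gfun _ _ _ (fG _)) => /=.
  by apply: clG; exact: fG.
have [f' f'E] := exists_linear lf.
have [u v|g gE] := injA (f := f').
  rewrite !f'E => fuv; apply: val_inj; apply/eqP; rewrite -subr_eq0; apply/eqP.
  apply: G0r; have := clG (-1) _ _ _ _ (fG v) (fG u).
  by rewrite !mulN1r fuv addNr addrC.
exists (g 1) => x y Gxy.
have xS : x \in submod_pred closedS by apply/asboolP; exists y.
rewrite -[RHS](linear_regularE g); have := gE (Submodule xS).
by rewrite f'E /= => ->; exact: Gfun Gxy (fG (Submodule xS)).
Qed.

End PartialIso.

(** [Zorn_bigcup] also asks for the union of the empty chain, so the empty set is added to the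
    family in [P'] and discarded afterwards. *)
Lemma Zorn_above T (P : set (set T)) (X0 : set T) : P X0 ->
  (forall F : set (set T), (exists X, F X) -> (forall X, F X -> P X) ->
     total_on F subset -> P (\bigcup_(X in F) X)%classic) ->
  exists X, [/\ P X, (X0 `<=` X)%classic &
    forall Y, P Y -> (X `<=` Y)%classic -> (Y `<=` X)%classic].
Proof.
move=> PX0 PF.
pose P' : set (set T) := fun X => X = set0 \/ P X /\ (X0 `<=` X)%classic.
have [F FP' totF|X [P'X maxX]] := @Zorn_bigcup T P'.
  have [[X [FX Xn0]]|F0] := pselect (exists X, F X /\ X <> set0); last first.
    left; rewrite -subset0 => x [X FX Xx]; apply: F0; exists X; split=> // X0'.
    by rewrite X0' in Xx.
  pose F' X := F X /\ X <> set0.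
  have -> : (\bigcup_(Z in F) Z = \bigcup_(Z in F') Z)%classic.
    apply/seteqP; split=> x [Z FZ Zx]; exists Z => //; last by case: FZ.
    by split=> // Z0; rewrite Z0 in Zx.
  have F'P Z : F' Z -> P Z /\ (X0 `<=` Z)%classic.
    by case=> /FP' [].
  right; split.
    apply: PF => [|Z /F'P[] //|]; first by exists X.
    by move=> Y Z [FY _] [FZ _]; exact: totF.
  by move=> x X0x; exists X => //; exact: (F'P X _).2.
(* If [X0] is nonempty, a maximal [X] cannot be the added empty set; if [X0] is empty, the empty set
   satisfies [P] anyway. *)
have [X0n|/nonemptyPn X0e] := pselect (X0 !=set0)%classic.
  have [X00|[PX X0X]] := P'X.
    case: (maxX X0); last by right; split.
    split; rewrite X00; first exact: sub0set.
    by case: X0n => x X0x /(_ x X0x).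
  exists X; split=> // Y PY XY; apply: contrapT => nYX.
  by apply: (maxX Y) => //; right; split=> //; exact: subset_trans X0X XY.
have PX : P X by case: P'X => [->|[]//]; rewrite -X0e.
exists X; split=> //; first by rewrite X0e; exact: sub0set.
move=> Y PY XY; apply: contrapT => nYX; apply: (maxX Y) => //.
by right; split=> //; rewrite X0e; exact: sub0set.
Qed.

(** * Essential complements and maximal partial isomorphisms *)

Section Ideals.
Variable A : pzRingType.
Implicit Types (G : set (A * A)) (E I J N W : set A).

(** A complement in the essential sense: [N + W] is direct and meets every nonzero cyclic submodule
    of [E] nontrivially, but it need not exhaust [E]. *)
Definition is_complement E N W :=
  [/\ left_ideal W, (W `<=` E)%classic, forall x, N x -> W x -> x = 0 &
      forall x, E x -> x <> 0 ->
        exists a n w, [/\ N n, W w, a * x = n + w & a * x <> 0]].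

Lemma exists_complement E N :
  left_ideal E -> left_ideal N -> exists W, is_complement E N W.
Proof.
move=> iE iN.
pose P W := [/\ left_ideal W, (W `<=` E)%classic &
                forall x, N x -> W x -> x = 0].
have [||W [[iW WE NW] _ maxW]] := @Zorn_above A P [set 0]%classic.
- split=> [|x ->|//]; last by case: iE.
  by split=> // a x y -> ->; rewrite /= mulr0 addr0.
- move=> F [X FX] FP totF; split.
  + split; first by exists X => //; have [[]] := FP X FX.
    move=> a x y [Y FY Yx] [Z FZ Zy].
    have [YZ|ZY] := totF _ _ FY FZ.
      by exists Z => //; have [[_ clZ] _ _] := FP Z FZ;
        apply: clZ => //; exact: YZ.
    by exists Y => //; have [[_ clY] _ _] := FP Y FY;
      apply: clY => //; exact: ZY.
  + by move=> x [Y FY Yx]; have [_ + _] := FP Y FY; exact.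
  + by move=> x Nx [Y FY Yx]; have [_ _] := FP Y FY; exact.
exists W; split=> // x Ex x0.
have [iN0 _] := iN; have [iW0 _] := iW.
(* [W' = Ax + W]. If it avoids [N], maximality puts [x] in [W]; otherwise a nonzero element
   [b * x + w] of [N] exhibits [b * x] in [N + W]. *)
pose W' := [set y | exists a w, W w /\ y = a * x + w]%classic.
have iW' : left_ideal W'.
  split; first by exists 0, 0; rewrite mul0r addr0.
  move=> a y z [b [w [Ww ->]]] [c [w' [Ww' ->]]].
  exists (a * b + c), (a * w + w'); split; first by case: iW => _; exact.
  by rewrite mulrDr mulrDl !mulrA addrACA.
have [NW'|] := pselect (forall y, N y -> W' y -> y = 0).
  exists 1, 0, x; split=> //; rewrite ?add0r ?mul1r //.
  apply: (maxW W'); last by exists 1, 0; rewrite mul1r addr0.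
    split=> // y [b [w [Ww ->]]]; apply: left_idealD (WE _ Ww) => //.
    exact: left_idealM.
  by move=> w Ww; exists 0, w; rewrite mul0r add0r.
move=> /existsNP[y /not_implyP[Ny /not_implyP[[b [w [Ww yE]]] y0]]].
exists b, y, (- w); split=> //; first exact: left_idealN.
  by rewrite yE addrK.
by move=> bx0; apply: y0; apply: NW => //; rewrite yE bx0 add0r.
Qed.

Definition inside E G := forall x y, G (x, y) -> E x /\ E y.

Definition max_partial_iso E G := [/\ partial_iso G, inside E G &
  forall G', partial_iso G' -> inside E G' -> (G `<=` G')%classic ->
    (G' `<=` G)%classic].

Lemma exists_max_partial_iso E G0 : partial_iso G0 -> inside E G0 ->
  exists G, max_partial_iso E G /\ (G0 `<=` G)%classic.
Proof.
move=> pG0 E0.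
have [||G [[pG GE] G0G maxG]] :=
  @Zorn_above _ (fun G => partial_iso G /\ inside E G) G0; first by [].
  move=> F [X FX] FP totF; split; last first.
    by move=> x y [Y FY Yx]; have [_] := FP Y FY; exact.
  split.
  - by exists X => //; have [[]] := FP X FX.
  - move=> a x y x' y' [Y FY Yx] [Z FZ Zy].
    have [YZ|ZY] := totF _ _ FY FZ.
      by exists Z => //; have [[_ clZ _ _] _] := FP Z FZ;
        apply: clZ => //; exact: YZ.
    by exists Y => //; have [[_ clY _ _] _] := FP Y FY;
      apply: clY => //; exact: ZY.
  - by move=> y [Y FY Yx]; have [[_ _ + _] _] := FP Y FY; exact.
  - by move=> y [Y FY Yx]; have [[_ _ _ +] _] := FP Y FY; exact.
by exists G; split=> //; split=> // G' pG' EG' GG'; exact: maxG.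
Qed.

Definition converse G : set (A * A) := [set p | G (p.2, p.1)]%classic.

Lemma partial_iso_converse G : partial_iso G -> partial_iso (converse G).
Proof. by case=> G0 clG Gl Gr; split=> // a x y x' y'; exact: clG. Qed.

Lemma max_partial_iso_converse E G :
  max_partial_iso E G -> max_partial_iso E (converse G).
Proof.
case=> pG GE maxG; split=> [|x y /GE[]//|G' pG' G'E GG' [x y] /= G'xy].
  exact: partial_iso_converse.
have := maxG (converse G') (partial_iso_converse pG').
by apply=> // [x' y' /G'E[]//|[x' y'] /= Gxy]; exact: GG'.
Qed.

Definition dom G : set A := [set x | exists y, G (x, y)]%classic.

Lemma dom_left_ideal G : partial_iso G -> left_ideal (dom G).
Proof.
case=> G0 clG _ _; split=> [|a x y [x' Gx] [y' Gy]]; first by exists 0.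
by exists (a * x' + y'); exact: clG.
Qed.

(** * Consequences of maximality over a regular ring *)

Hypothesis regA : von_neumann_regular A.
Hypothesis extA : forall G, partial_iso G ->
  exists r, forall x y, G (x, y) -> y = x * r.

(** A nonzero [t * r] would let [G] be enlarged by an isomorphism from a cyclic submodule of [W]
    onto [A(t * r)] in [W']. *)
Lemma max_partial_iso_orthogonal E G W W' : left_ideal E ->
  max_partial_iso E G ->
  is_complement E (dom G) W -> is_complement E (dom (converse G)) W' ->
  forall t r, W t -> W' (t * r) -> t * r = 0.
Proof.
move=> iE [pG GE maxG] [iW WE GW _] [iW' W'E GW' _] t r Wt W'tr.
have [q trq] := regA (t * r).
(* Right multiplication by [r] may have a kernel on [At]; the generalized inverse [q] supplies [t0]
   in [At] with [t0 * r = t * r] and no kernel on [At0]. Below, [G'] is [G + A(t0, t * r)]. *)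
pose t0 := t * r * q * t.
have Wt0 : W t0 by rewrite /t0; exact: left_idealM.
have t0r : t0 * r = t * r by rewrite /t0 -mulrA -trq.
have bt0 b : b * (t * r) = 0 -> b * t0 = 0.
  by move=> btr; rewrite /t0 !mulrA -(mulrA b) btr !mul0r.
pose G' := [set p | exists b, G (p.1 - b * t0, p.2 - b * (t * r))]%classic.
have [G0 clG G0l G0r] := pG.
have subG : (G `<=` G')%classic.
  by move=> [x y] Gxy; exists 0; rewrite /= !mul0r !subr0.
have G't0 : G' (t0, t * r) by exists 1; rewrite /= !mul1r !subrr.
have Nbt0 b : - (b * t0) = 0 -> b * t0 = 0.
  by move/eqP; rewrite oppr_eq0 => /eqP.
have domW b y : G (- (b * t0), y) -> b * t0 = 0.
  move=> Gb; apply/Nbt0/GW; first by exists y.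
  by apply: left_idealN => //; exact: left_idealM.
have codW b x : G (x, - (b * (t * r))) -> b * (t * r) = 0.
  move=> Gb; apply/eqP; rewrite -oppr_eq0; apply/eqP/GW'; first by exists x.
  by apply: left_idealN => //; exact: left_idealM.
have G'E : inside E G'.
  move=> x y [b /GE[/= Ex Ey]].
  rewrite -(subrK (b * t0) x) -(subrK (b * (t * r)) y).
  by split; apply: left_idealD => //; apply: left_idealM => //;
    [exact: WE | exact: W'E].
suff /maxG/(_ G'E subG (t0, t * r) G't0) Gt0 : partial_iso G'.
  by rewrite -t0r (GW t0) ?mul0r //; exists (t * r).
split.
- exact: subG.
- move=> a x y x' y' [b /= Gb] [c /= Gc]; exists (a * b + c) => /=.
  have := clG a _ _ _ _ Gb Gc; congr (G (_, _));
  by rewrite mulrBr addrACA mulrDl opprD [a * (b * _)]mulrA.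
- move=> y [b] /=; rewrite sub0r => Gb; have bt00 := domW _ _ Gb.
  by move: Gb; rewrite -t0r mulrA bt00 mul0r oppr0 addr0; exact: G0l.
- move=> x [b] /=; rewrite sub0r => Gb; have btr0 := codW _ _ Gb.
  by move: Gb; rewrite btr0 bt0 // oppr0 addr0; exact: G0r.
Qed.

(** No nonzero element of [J] is the image of an element of [Av] under a right multiplication.
    Besides being a left ideal, this set is stable under right multiplications, so it contains all
    [W h^i] as soon as it contains [W]. *)
Definition orthogonal_to J : set A :=
  [set v | forall a r, J (a * v * r) -> a * v * r = 0]%classic.

Lemma orthogonal_to_left_ideal J : left_ideal J -> left_ideal (orthogonal_to J).
Proof.
move=> iJ; split=> [a r _|a0 x y Ox Oy a r]; first by rewrite mulr0 mul0r.
move Es: (_ * r) => s Js; have [b sbs] := regA s.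
(* With [s = s * b * s], right multiplication by [f] sends each of the two terms separately into
   [As], hence into [J], where orthogonality kills it. *)
pose f := r * (b * s).
have ker c u : orthogonal_to J u -> c * u * f = 0.
  by move=> Ou; apply: Ou; rewrite /f !mulrA; exact: left_idealM.
have -> : s = a * a0 * x * f + a * y * f.
  by rewrite {1}sbs -{1}Es mulrDr !mulrDl /f !mulrA.
by rewrite (ker _ _ Ox) (ker _ _ Oy) addr0.
Qed.

(** For an idempotent [e] this is the left ideal [Ae]. *)
Definition principal e : set A := [set x | x * e = x]%classic.

Lemma principal_left_ideal e : left_ideal (principal e).
Proof.
split=> [|a x y xe ye]; rewrite /principal /= ?mul0r //.
by rewrite mulrDl -mulrA xe ye.
Qed.

Definition essential E N := forall x, E x -> x <> 0 ->
  exists a, N (a * x) /\ a * x <> 0.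

(* V is the sum of the W h^i, where right multiplication by h extends the
   inverse of G; the conclusions say that this sum is direct and infinite. *)
Lemma max_partial_iso_shift e G W : e * e = e ->
  max_partial_iso (principal e) G ->
  is_complement (principal e) (dom G) W ->
  exists (V : set A) h,
    [/\ left_ideal V, (W `<=` V)%classic, (V `<=` principal e)%classic,
        forall v, V v -> V (v * h) & forall v, V v ->
        [/\ v * h = 0 -> v = 0, W (v * h) -> v = 0 &
            exists w v', [/\ W w, V v' & v = w + v' * h]]].
Proof.
move=> ee maxG cW; set E := principal e.
have iE : left_ideal E := principal_left_ideal e.
have maxG' := max_partial_iso_converse maxG.
have [pG GE _] := maxG; have [pG' G'E _] := maxG'.
have iN' := dom_left_ideal pG'.
have [W' cW'] := exists_complement iE iN'.
have orth := max_partial_iso_orthogonal iE maxG cW cW'.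
(* [h] still extends the inverse of [G], since [G] lies in [Ae]; the factor [e] makes its values
   stay in [Ae]. *)
have [r hr] := extA pG'; pose h := r * e.
have hG x y : G (x, y) -> y * h = x.
  by move=> Gxy; rewrite /h mulrA -(hr y x) //; case: (GE _ _ Gxy).
have [iW WE GW _] := cW; have [iW' W'E GW' essW'] := cW'.
(* The least left ideal that contains [W] and is stable under [h]; properties of [V] are obtained by
   choosing a suitable [J]. *)
pose V := [set v | forall J, left_ideal J -> (W `<=` J)%classic ->
                   (forall w, J w -> J (w * h)) -> J v]%classic.
have iV : left_ideal V.
  split=> [J [] //|a x y Vx Vy J iJ WJ Jh].
  by have [_] := iJ; apply; [exact: Vx | exact: Vy].
have WV : (W `<=` V)%classic by move=> w Ww J _ WJ _; exact: WJ.
have VE : (V `<=` E)%classic.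
  move=> v Vv; apply: (Vv E) => // w Ew.
  by rewrite /E /principal /= /h -!mulrA ee.
have Vh v : V v -> V (v * h) by move=> Vv J iJ WJ Jh; apply: (Jh); exact: Vv.
have VO : (V `<=` orthogonal_to W')%classic.
  move=> v Vv; apply: (Vv (orthogonal_to W')).
    exact: orthogonal_to_left_ideal.
    by move=> w Ww a b; apply: orth; exact: left_idealM.
  by move=> w Ow a b; rewrite [a * (w * h)]mulrA -[_ * h * b]mulrA; exact: Ow.
(* The range of [G] is essential in [V]. In [a * v = m + m1], the element [c] kills [a * v], so
   [c * m1 = - c * m] lies in the range of [G] and in [W'], hence is 0. Thus
   [m1 = a * v * (q * m1)], and orthogonality of [V] to [W'] gives [m1 = 0]. *)
have essV v : V v -> v <> 0 -> exists a x, G (x, a * v) /\ a * v <> 0.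
  move=> Vv v0; have [a [m [m1 [Nm Wm1 avE av0]]]] := essW' v (VE v Vv) v0.
  suff m10 : m1 = 0.
    by have [x Gx] := Nm; exists a, x; rewrite avE m10 addr0 in av0 *.
  have [q wqw] := regA (a * v).
  pose c := a * v * q - 1.
  have cm : c * m + c * m1 = 0 by rewrite -mulrDr -avE mulrBl mul1r -wqw subrr.
  have cm10 : c * m1 = 0.
    apply: (GW' (c * m1)); last exact: left_idealM.
    rewrite -[c * m1](addKr (c * m)) cm addr0.
    by apply: left_idealN => //; exact: left_idealM.
  have m1E : a * v * (q * m1) = m1.
    by move/eqP: cm10; rewrite mulrBl mul1r subr_eq0 mulrA => /eqP.
  by rewrite -m1E; apply: (VO v Vv); rewrite m1E.
exists V, h; split=> // v Vv; split.
- move=> vh0; apply: contrapT => v0; have [a [x [Gx av0]]] := essV v Vv v0.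
  by apply: av0; have := hG _ _ Gx; rewrite -mulrA vh0 mulr0 => x0;
    move: Gx; rewrite -x0; case: pG => _ _ + _; exact.
- move=> Wvh; apply: contrapT => v0; have [a [x [Gx av0]]] := essV v Vv v0.
  have xE := hG _ _ Gx; apply: av0.
  have x0 : x = 0.
    apply: GW; first by exists (a * v).
    by rewrite -xE -mulrA; exact: left_idealM.
  by move: Gx; rewrite x0; case: pG => _ _ + _; exact.
(* [J = W + V h]; minimality of [V] gives that it contains [V]. *)
- pose J := [set v | exists w v', [/\ W w, V v' & v = w + v' * h]]%classic.
  suff [] : (J `&` V)%classic v by [].
  apply: (Vv (J `&` V)%classic).
  + split.
      by split; [exists 0, 0; rewrite mul0r addr0; case: iW; case: iV
                | case: iV].
    move=> a x y [[w [v1 [Ww Vv1 ->]]] Vx] [[w' [v2 [Ww' Vv2 ->]]] Vy].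
    split; last by case: iV => _; exact.
    exists (a * w + w'), (a * v1 + v2); split.
    * by case: iW => _; exact.
    * by case: iV => _; exact.
    * by rewrite mulrDr mulrDl mulrA addrACA.
  + move=> w Ww; split; last exact: WV.
    by exists w, 0; split=> //; [case: iV | rewrite mul0r addr0].
  + move=> w [_ Vw]; split; last exact: Vh.
    by exists 0, w; split=> //; [case: iW | rewrite add0r].
Qed.

(** * Maps between cyclic projectives and absorbed essential closures *)

Lemma partial_iso_corner G (e f : A) : partial_iso G ->
  e * e = e -> f * f = f ->
  (forall x y, G (x, y) -> x * e = x /\ y * f = y) ->
  exists r, [/\ e * r = r, r * f = r & forall x y, G (x, y) -> y = x * r].
Proof.
move=> pG ee ff Gef; have [r Gr] := extA pG.
exists (e * r * f); split=> [||x y Gxy]; rewrite ?mulrA ?ee //.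
  by rewrite -mulrA ff.
by have [xe yf] := Gef _ _ Gxy; rewrite xe -(Gr _ _ Gxy) yf.
Qed.

(** A monomorphism [Ae -> Af] splits: if [r = r * b * r], then [e - r * (f * b * e)] lies in [Ae]
    and is killed by [r]. *)
Lemma right_inverse_corner (e f r : A) : e * e = e -> f * f = f ->
  e * r = r -> r * f = r -> (forall x, x * e = x -> x * r = 0 -> x = 0) ->
  exists q, [/\ f * q = q, q * e = q & r * q = e].
Proof.
move=> ee ff er rf injr; have [b rbr] := regA r.
exists (f * b * e); split; rewrite ?mulrA ?ff // ?rf.
  by rewrite -mulrA ee.
apply/esym/eqP; rewrite -subr_eq0; apply/eqP/injr.
  by rewrite mulrBl -(mulrA _ e e) ee.
by rewrite mulrBl -(mulrA _ e) er -rbr subrr.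
Qed.

Definition orth_sum (e f g : A) :=
  [/\ e = f + g, f * f = f, g * g = g, f * g = 0 & g * f = 0].

(** For idempotents, this is the isomorphism of [Ae] and [Af]. *)
Definition idem_equiv (e f : A) := exists x y : A, x * y = e /\ y * x = f.

(** The idempotent form of [Ae + An ~ Ae]. *)
Definition absorbs e n :=
  exists f g, [/\ orth_sum e f g, idem_equiv e f & idem_equiv g n].

Lemma max_partial_iso_closure (e : A) G W : e * e = e ->
  max_partial_iso (principal e) G ->
  is_complement (principal e) (dom G) W ->
  exists n, [/\ n * n = n /\ absorbs e n, e * n = n, n * e = n,
    (W `<=` principal n)%classic & essential (principal n) W].
Proof.
move=> ee maxG cW; have [iW WE _ _] := cW.
have [V [h [iV WV VE Vh hV]]] := max_partial_iso_shift ee maxG cW.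
(* s acts as h on V and as the identity on the complement U of V; it is
   injective with cokernel A z, in which W embeds essentially. *)
have [U [iU UE VU essU]] := exists_complement (principal_left_ideal e) iV.
pose G1 := [set p : A * A | exists v u,
  [/\ V v, U u, p.1 = v + u & p.2 = v * h + u]]%classic.
have pG1 : partial_iso G1.
  split.
  - exists 0, 0; rewrite /= mul0r addr0.
    by split=> //; [case: iV | case: iU].
  - move=> a x y x' y' [v [u [/= Vv Uu -> ->]]] [v' [u' [/= Vv' Uu' -> ->]]].
    exists (a * v + v'), (a * u + u'); split.
    + by case: iV => _; exact.
    + by case: iU => _; exact.
    + by rewrite /= mulrDr addrACA.
    + by rewrite /= mulrDr mulrDl addrACA mulrA.
  - move=> y [v [u [/= Vv Uu /esym/eqP + ->]]].
    rewrite addr_eq0 => /eqP vu; have v0 : v = 0.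
      by apply: VU => //; rewrite vu; exact: left_idealN.
    by rewrite v0 mul0r add0r -[u]opprK -vu v0 oppr0.
  - move=> x [v [u [/= Vv Uu -> /esym/eqP]]].
    rewrite addrC addr_eq0 => /eqP uvh; have u0 : u = 0.
      by apply: VU => //; rewrite uvh; apply: left_idealN => //; exact: Vh.
    have [v0 _ _] := hV v Vv.
    by rewrite u0 v0 ?addr0 // -[v * h]opprK -uvh u0 oppr0.
have [|s [es se sG1]] := partial_iso_corner pG1 ee ee.
  move=> x y [v [u [/= Vv Uu -> ->]]].
  have ve : v * e = v by exact: VE.
  have ue : u * e = u by exact: UE.
  have vhe : v * h * e = v * h by apply/VE/Vh.
  by rewrite !mulrDl ve ue vhe.
have sE v u : V v -> U u -> (v + u) * s = v * h + u.
  by move=> Vv Uu; apply/esym/sG1; exists v, u.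
have injs x : x * e = x -> x * s = 0 -> x = 0.
  move=> xe xs; apply: contrapT => x0.
  have [a [v [u [Vv Uu axE ax0]]]] := essU x xe x0.
  apply: ax0; case: pG1 => _ _ _; apply.
  exists v, u; split=> //=.
  by rewrite -sE // -axE -mulrA xs mulr0.
have [t [et te st]] := right_inverse_corner ee ee es se injs.
(* As [s * t = e], the idempotent [t * s] is equivalent to [e] and generates the image of [s]; right
   multiplication by [z] is the projection of [Ae] onto the cokernel [Az]. *)
pose z := e - t * s.
have tsts : t * s * (t * s) = t * s by rewrite -mulrA (mulrA s) st es.
have ez : e * z = z by rewrite /z mulrBr ee mulrA et.
have ze : z * e = z by rewrite /z mulrBl ee -mulrA se.
have sz : s * z = 0 by rewrite /z mulrBr se mulrA st es subrr.
have tsz : t * s * z = 0 by rewrite -mulrA sz mulr0.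
have zz : z * z = z by rewrite {1}/z mulrBl ez tsz subr0.
have zts : z * (t * s) = 0 by rewrite /z mulrBl tsts mulrA et subrr.
(* [W] meets the image of [s] trivially: if [m = (m * t) * s], a multiple [v + u] of [m * t] has
   [v * h + u] in [W], so [u] is in both [U] and [V], and then [v * h] in [W] forces [v = 0]. *)
have Wz m : W m -> m * z = 0 -> m = 0.
  move=> Wm; have me : m * e = m by exact: WE.
  rewrite /z mulrBr me mulrA => /eqP; rewrite subr_eq0 => /eqP mE.
  apply: contrapT => m0; have x0 : m * t <> 0.
    by move=> mt; apply: m0; rewrite mE mt mul0r.
  have xe : principal e (m * t) by rewrite /principal /= -mulrA te.
  have [a [v [u [Vv Uu axE ax0]]]] := essU _ xe x0.
  have amE : a * m = v * h + u by rewrite -sE // -axE -!mulrA [m * _]mulrA -mE.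
  have Wam : W (a * m) by exact: left_idealM.
  have u0 : u = 0.
    apply: VU => //; have -> : u = a * m - v * h by rewrite amE addrC addKr.
    by apply: left_idealB => //; [exact: WV | exact: Vh].
  have [_ v0 _] := hV v Vv; apply: ax0; rewrite axE u0 addr0; apply: v0.
  by move: amE; rewrite u0 addr0 => <-.
(* [Wz] is essential in [Az]: in [a * y = m + (v' * h + u)] the bracket is [(v' + u) * s], which [z]
   kills. *)
have essz y : y * z = y -> y <> 0 ->
    exists a m, [/\ W m, a * y = m * z & a * y <> 0].
  move=> yz y0; have ye : principal e y by rewrite /principal /= -yz -mulrA ze.
  have [a [v [u [Vv Uu ayE ay0]]]] := essU _ ye y0.
  have [_ _ [m [v' [Wm Vv' vE]]]] := hV v Vv.
  exists a, m; split=> //; rewrite -yz mulrA ayE vE -addrA -sE //.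
  by rewrite mulrDl -mulrA sz mulr0 addr0.
(* The inverse of [W -> Wz] extends to [r : Az -> Ae], which is injective since [Wz] is essential in
   [Az]. The closure [An] is the image of [r]. *)
pose G2 := [set p : A * A | W p.2 /\ p.1 = p.2 * z]%classic.
have pG2 : partial_iso G2.
  split.
  - by split=> /=; [case: iW | rewrite mul0r].
  - move=> a x y x' y' [/= Wy ->] [/= Wy' ->]; split=> /=.
      by case: iW => _; exact.
    by rewrite mulrDl mulrA.
  - by move=> y [/= Wy /esym]; exact: Wz.
  - by move=> x [/= _ ->]; rewrite mul0r.
have [|r [zr re rG2]] := partial_iso_corner pG2 zz ee.
  by move=> x y [/= Wy ->]; split; [rewrite -mulrA zz | exact: WE].
have rW m : W m -> m * z * r = m by move=> Wm; apply/esym/rG2.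
have injr y : y * z = y -> y * r = 0 -> y = 0.
  move=> yz yr; apply: contrapT => y0.
  have [a [m [Wm ayE ay0]]] := essz _ yz y0.
  by apply: ay0; rewrite ayE -[m]rW // -ayE -(mulrA a y r) yr mulr0 mul0r.
have [q [eq qz rq]] := right_inverse_corner zz ee zr re injr.
exists (q * r); split.
- split; first by rewrite -mulrA (mulrA r) rq zr.
  exists (t * s), z; split; first by split=> //; rewrite /z addrC subrK.
    by exists s, t.
  by exists r, q.
- by rewrite mulrA eq.
- by rewrite -mulrA re.
- move=> m Wm; rewrite /principal /= -{1}(rW m Wm) -!mulrA (mulrA r) rq zr.
  by rewrite mulrA rW.
- move=> x xn x0; have xqr : x * q * r = x by rewrite -mulrA.
  have [||a [m [Wm axqE axq0]]] := essz (x * q).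
  + by rewrite -mulrA qz.
  + by move=> xq0; apply: x0; rewrite -xqr xq0 mul0r.
  have axE : a * x = m by rewrite -xqr mulrA axqE rW.
  exists a; rewrite axE; split=> // m0.
  by apply: axq0; rewrite axqE m0 mul0r.
Qed.

(** * Adjusting idempotents and complements *)

Lemma idem_equiv_trans e f g : e * e = e -> g * g = g ->
  idem_equiv e f -> idem_equiv f g -> idem_equiv e g.
Proof.
move=> ee gg [x [y [xy yx]]] [u [v [uv vu]]]; exists (x * u), (v * y).
split; first by rewrite mulrA -(mulrA x) uv -yx mulrA xy -mulrA xy.
by rewrite mulrA -(mulrA v) yx -uv mulrA vu -mulrA vu.
Qed.

(** [f] is another projection onto the left ideal [An], chosen so that it kills [Al]; this is
    possible because [An] and [Al] are independent. *)
Lemma independent_idempotent (e n l : A) : e * e = e ->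
  n * n = n -> e * n = n -> n * e = n -> l * l = l -> l * e = l ->
  (forall x, x * n = x -> x * l = x -> x = 0) ->
  exists f, [/\ f * f = f, e * f = f, f * e = f, n * f = n /\ f * n = f
               & l * f = 0].
Proof.
move=> ee nn en ne ll le nl0.
pose w := l - l * n; have [q0 wqw0] := regA w; pose q := e * q0.
have we : w * e = w by rewrite /w mulrBl le -mulrA ne.
have wqw : w * q * w = w by rewrite /q mulrA we -wqw0.
have eq : e * q = q by rewrite /q mulrA ee.
clearbody q.
have wn : w * n = 0 by rewrite /w mulrBl -mulrA nn subrr.
(* The difference of the two sides lies in [Al], and [w = w * q * w] puts it in [An] as well. *)
have lE : l = w * q * l.
  apply/eqP; rewrite -subr_eq0; apply/eqP/nl0; last first.
    by rewrite mulrBl -!mulrA ll.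
  have : w * q * l - w * q * l * n = l - l * n.
    by rewrite -[RHS]/w -[RHS]wqw {4}/w mulrBr !mulrA.
  move: (w * q * l) => u E; rewrite mulrBl; apply: (addIr u).
  by rewrite subrK -addrA [- _ + u]addrC E addrC subrK.
(* The correction to [n] is [(1 - n) * q * l * n]; [l] times it is [w * q * l * n = l * n], so it
   cancels [l * n]. *)
pose f := n - (q * l * n - n * q * l * n).
have nf : n * f = n by rewrite /f !mulrBr !mulrA nn subrr subr0.
have fn : f * n = f by rewrite /f !mulrBl -!mulrA nn.
exists f; split=> //.
- by rewrite -[X in X * f]fn -mulrA nf.
- by rewrite /f !mulrBr !mulrA eq en.
- by rewrite /f !mulrBl -!mulrA ne.
- have : w * q * l * n = l * n by rewrite -lE.
  rewrite /f !mulrBr {1}/w !mulrBl !mulrA => ->; exact: subrr.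
Qed.

(** Since [l * n = 0], the element [c = l - n * l] is an idempotent orthogonal to [n] with
    [Ac = Al]. Hence [e = n + k + c], and [n + k = e - c] and [e - l] give two complements of the
    same left ideal in [Ae]. *)
Lemma complement_split (e n l : A) : e * e = e ->
  n * n = n -> e * n = n -> n * e = n -> l * l = l -> e * l = l -> l * e = l ->
  l * n = 0 ->
  let k := e - n - (l - n * l) in
  [/\ k * k = k, n * k = 0 /\ k * n = 0, e * k = k /\ k * e = k,
      l * k = 0 & idem_equiv (e - l) (n + k)].
Proof.
move=> ee nn en ne ll el le ln k.
have nk : n * k = 0 by rewrite /k !mulrBr ne nn !mulrA nn !subrr.
have kn : k * n = 0 by rewrite /k !mulrBl en nn -mulrA ln mulr0 !subrr.
have ek : e * k = k by rewrite /k !mulrBr ee en el mulrA en.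
have ke : k * e = k by rewrite /k !mulrBl ee ne le -mulrA le.
have lk : l * k = 0 by rewrite /k !mulrBr le ln ll mulrA ln mul0r !subr0 subrr.
have kk : k * k = k.
  rewrite {1}/k mulrBl [(e - n) * k]mulrBl ek nk mulrBl lk.
  by rewrite -mulrA lk mulr0 !subr0.
split=> //; exists (n + k), (e - l); split.
  have -> : n + k = e - (l - n * l) by rewrite /k addrA [n + _]addrC subrK.
  have cl : (l - n * l) * l = l - n * l by rewrite mulrBl ll -mulrA ll.
  have ce : (l - n * l) * e = l - n * l by rewrite mulrBl le -mulrA le.
  move: (l - n * l) cl ce => c cl ce.
  by rewrite mulrBr !mulrBl ee ce el cl opprB addrA subrK.
by rewrite mulrBl mulrDr en ek mulrDr ln lk addr0 subr0.
Qed.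

(** * Extending partial isomorphisms modulo closures *)

Lemma dom_disjoint_closure E G W n : partial_iso G ->
  is_complement E (dom G) W -> essential (principal n) W ->
  forall x, dom G x -> x * n = x -> x = 0.
Proof.
move=> pG [_ _ GW _] essn x Gx xn; apply: contrapT => x0.
have [a [Wax]] := essn x xn x0; apply; apply: GW Wax.
exact: left_idealM (dom_left_ideal pG) Gx.
Qed.

(** Right multiplication by [e - n] is the projection of [Ae] modulo [An]. It is injective on the
    domain of [G], and likewise [e - n'] on the range, so [G] induces a partial isomorphism [H]
    between the quotients, which extends. *)
Lemma quotient_extension (e n n' : A) G : e * e = e ->
  n * n = n -> e * n = n -> n * e = n ->
  n' * n' = n' -> e * n' = n' -> n' * e = n' ->
  partial_iso G -> inside (principal e) G ->
  (forall x, dom G x -> x * n = x -> x = 0) ->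
  (forall y, dom (converse G) y -> y * n' = y -> y = 0) ->
  exists r, [/\ (e - n) * r = r, r * (e - n') = r &
    forall x y, G (x, y) -> x * (e - n) * r = y * (e - n')].
Proof.
move=> ee nn en ne nn' en' ne' pG GE Gn Gn'.
have idem f : f * f = f -> e * f = f -> f * e = f ->
    (e - f) * (e - f) = e - f.
  by move=> ff ef fe; rewrite mulrBl !mulrBr ee ef fe ff subrr subr0.
have [G0 clG Gl Gr] := pG.
pose H := [set p : A * A | exists x y,
  [/\ G (x, y), p.1 = x * (e - n) & p.2 = y * (e - n')]]%classic.
have pH : partial_iso H.
  split.
  - by exists 0, 0; rewrite /= !mul0r.
  - move=> a x y x' y' [u [v [/= Guv -> ->]]] [u' [v' [/= Guv' -> ->]]].
    exists (a * u + u'), (a * v + v'); split=> /=; first exact: clG.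
      by rewrite mulrDl mulrA.
    by rewrite mulrDl mulrA.
  - move=> y [u [v [/= Guv + ->]]]; have [ue _] := GE _ _ Guv.
    rewrite mulrBr ue => /esym/eqP; rewrite subr_eq0 => /eqP un.
    have u0 : u = 0 by apply: Gn; [exists v | rewrite -un].
    by rewrite (Gl v) ?mul0r // -u0.
  - move=> x [u [v [/= Guv -> ]]]; have [_ ve] := GE _ _ Guv.
    rewrite mulrBr ve => /esym/eqP; rewrite subr_eq0 => /eqP vn.
    have v0 : v = 0 by apply: Gn'; [exists u | rewrite -vn].
    by rewrite (Gr u) ?mul0r // -v0.
have en_idem := idem n nn en ne; have en'_idem := idem n' nn' en' ne'.
have Hcorner u v : H (u, v) -> u * (e - n) = u /\ v * (e - n') = v.
  by move=> [x [y [_ /= -> ->]]]; rewrite -!mulrA en_idem en'_idem.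
have [r [er re Hr]] := partial_iso_corner pH en_idem en'_idem Hcorner.
exists r; split=> // x y Gxy.
by apply/esym/Hr; exists x, y.
Qed.

(** [dom G + W] is essential in [Ae], and [W] dies modulo [An]. By regularity [d] acts injectively
    on [Az], so a nonzero multiple of [z] in [dom G + W] cannot be killed by [d]. *)
Lemma quotient_ext_eq0 (e n d : A) G W : e * e = e ->
  n * n = n -> e * n = n -> n * e = n ->
  is_complement (principal e) (dom G) W -> (W `<=` principal n)%classic ->
  (e - n) * d = d -> (forall x, dom G x -> x * (e - n) * d = 0) -> d = 0.
Proof.
move=> ee nn en ne [_ WE _ essW] Wn nd Gd.
have [q dqd] := regA d; pose z := d * q * (e - n).
have zd : z * d = d by rewrite /z -mulrA nd -dqd.
have zn : z * (e - n) = z.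
  by rewrite /z -mulrA mulrBl !mulrBr ee en ne nn subrr subr0.
apply: contrapT => d0.
have ze : principal e z.
  by rewrite /principal /= /z -mulrA mulrBl ee ne.
have [|a [x [m [Gx Wm azE az0]]]] := essW z ze.
  by move=> z0; apply: d0; rewrite -zd z0 mul0r.
have mn : m * (e - n) = 0.
  have -> : m = m * e by rewrite (WE m Wm).
  have mE := WE _ Wm; have mN := Wn _ Wm.
  by rewrite mulrBr -!mulrA ee en mE mN subrr.
apply: az0; have ad : a * d = 0.
  by rewrite -zd mulrA -zn mulrA azE mulrDl mn addr0 Gd.
by rewrite /z !mulrA ad !mul0r.
Qed.

Lemma idem_equiv_corner (e f : A) : e * e = e -> f * f = f -> idem_equiv e f ->
  exists x y, [/\ x * y = e, y * x = f, e * x = x /\ x * f = x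
                & f * y = y /\ y * e = y].
Proof.
move=> ee ff [x [y [xy yx]]].
have exf : e * x = x * f by rewrite -xy -yx mulrA.
have fye : f * y = y * e by rewrite -xy -yx mulrA.
exists (e * x), (f * y); split.
- by rewrite fye mulrA -(mulrA e) xy !ee.
- by rewrite exf mulrA -(mulrA f) yx !ff.
- by split; [rewrite mulrA ee | rewrite exf -mulrA ff].
- by split; [rewrite mulrA ff | rewrite fye -mulrA ee].
Qed.

(** The idempotent form of [absorption]: [e - l], [e - l'] and [l] stand for [K], [K'] and [L], and
    [k], [n], [n'] for [K0], [K1], [K1']. *)
Lemma complement_absorption (e l l' : A) : e * e = e ->
  l * l = l -> e * l = l -> l * e = l ->
  l' * l' = l' -> e * l' = l' -> l' * e = l' -> idem_equiv l l' ->
  exists n k n' k', [/\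
    [/\ n * n = n, k * k = k, n * k = 0 & k * n = 0],
    [/\ n' * n' = n', k' * k' = k', n' * k' = 0 & k' * n' = 0],
    idem_equiv (e - l) (n + k) /\ idem_equiv (e - l') (n' + k'),
    idem_equiv k k' & absorbs e n /\ absorbs e n'].
Proof.
move=> ee ll el le ll' el' le' /(idem_equiv_corner ll ll').
move=> [x [y [xy yx [lx xl'] [l'y yl]]]].
pose G0 := [set p : A * A | p.1 * l = p.1 /\ p.2 = p.1 * x]%classic.
have pG0 : partial_iso G0.
  split; rewrite /G0 /=.
  - by rewrite !mul0r.
  - move=> a u v u' v' [ul ->] [ul' ->]; split; last by rewrite mulrDl mulrA.
    by rewrite mulrDl -mulrA ul ul'.
  - by move=> v [_ ->]; rewrite mul0r.
  - by move=> u [ul /esym ux]; rewrite -ul -xy mulrA ux mul0r.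
have [|G [maxG G0G]] := @exists_max_partial_iso (principal e) G0 pG0.
  move=> u v [/= ul ->]; split; rewrite /principal /=.
    by rewrite -ul -mulrA le.
  by rewrite -xl' -!mulrA le'.
have maxG' := max_partial_iso_converse maxG.
have [pG GE _] := maxG; have [pG' G'E _] := maxG'.
have iE := @principal_left_ideal e.
have [W cW] := exists_complement iE (dom_left_ideal pG).
have [W' cW'] := exists_complement iE (dom_left_ideal pG').
have Gl : G (l, x) by apply: G0G; split=> /=; rewrite ?ll ?lx.
have G'l : G (y, l').
  by apply: G0G; split=> /=; rewrite ?yl ?yx.
(* The closure of [W1] is independent of [Af] because [f] lies in the domain of [G1]; its idempotent
   can thus be replaced by one with the same left ideal that [f] kills on the left. *)
have adjust f G1 W1 : f * f = f -> f * e = f -> dom G1 f ->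
    max_partial_iso (principal e) G1 ->
    is_complement (principal e) (dom G1) W1 ->
    exists n, [/\ n * n = n, e * n = n /\ n * e = n, f * n = 0, absorbs e n &
      (W1 `<=` principal n)%classic /\
      forall u, dom G1 u -> u * n = u -> u = 0].
  move=> ff fe Gf max1 c1; have [p1 _ _] := max1.
  have [n0 [[nn0 absn0] en0 ne0 Wn0 essn0]] :=
    max_partial_iso_closure ee max1 c1.
  have dis := dom_disjoint_closure p1 c1 essn0.
  have [|n [nn en ne [n0n nn0'] fn]] :=
      independent_idempotent ee nn0 en0 ne0 ff fe.
    move=> u un uf; apply: dis un; rewrite -uf.
    exact: left_idealM (dom_left_ideal p1) Gf.
  exists n; split=> //.
    have [g [z [gz eg zn]]] := absn0; exists g, z; split=> //.
    case: gz => _ _ zz _ _; apply: idem_equiv_trans zn _ => //.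
    by exists n0, n.
  split=> [w /Wn0 wn0|u Gu un]; rewrite /principal /=.
    by rewrite -wn0 -mulrA n0n.
  by apply: dis => //; rewrite -{1}un -mulrA nn0'.
have [n [nn [en ne] ln absn [Wn disn]]] :=
  adjust l G W ll le (ex_intro _ x Gl) maxG cW.
have [n' [nn' [en' ne'] ln' absn' [Wn' disn']]] :=
  adjust l' (converse G) W' ll' le' (ex_intro _ y G'l) maxG' cW'.
have [r [nr rn' Gr]] :=
  quotient_extension ee nn en ne nn' en' ne' pG GE disn disn'.
have [r' [nr' rn Gr']] :=
  quotient_extension ee nn' en' ne' nn en ne pG' G'E disn' disn.
have xn' : x * n' = 0 by rewrite -xl' -mulrA ln' mulr0.
have yn : y * n = 0 by rewrite -yl -mulrA ln mulr0.
have lr : l * r = x.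
  have := Gr _ _ Gl; rewrite !mulrBr le ln xn' !subr0 => ->.
  by rewrite -xl' -mulrA le'.
have l'r' : l' * r' = y.
  have := Gr' l' y G'l; rewrite !mulrBr le' ln' yn !subr0 => ->.
  by rewrite -yl -mulrA le.
(* [s * s'] and [e - m] agree on the domain of [G1] modulo [Am], hence everywhere by
   [quotient_ext_eq0]. *)
have inverse m m' s s' G1 W1 : m * m = m -> e * m = m -> m * e = m ->
    is_complement (principal e) (dom G1) W1 -> (W1 `<=` principal m)%classic ->
    (e - m) * s = s ->
    (forall u v, G1 (u, v) -> u * (e - m) * s = v * (e - m')) ->
    (forall v u, G1 (u, v) -> v * (e - m') * s' = u * (e - m)) ->
    s * s' = e - m.
  move=> mm em me c1 Wm ms Gs Gs'; apply/eqP; rewrite eq_sym -subr_eq0.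
  apply/eqP; apply: (quotient_ext_eq0 ee mm em me c1 Wm).
    by rewrite mulrBr mulrA ms mulrBl !mulrBr ee em me mm subrr subr0.
  move=> u [v Guv]; rewrite [_ * (_ - s * s')]mulrBr [_ * (s * s')]mulrA.
  rewrite (Gs u v Guv) (Gs' v u Guv).
  by rewrite -mulrA !mulrBl !mulrBr ee em me mm subrr !subr0 subrr.
have rr' : r * r' = e - n.
  by apply: (inverse n n' r r' G W) => // v u; exact: Gr'.
have r'r : r' * r = e - n'.
  by apply: (inverse n' n r' r (converse G) W') => // v u; exact: Gr.
have [] := complement_split ee nn en ne ll el le ln.
set k := _ - _ => kk [nk kn] [ek ke] lk eqk.
have [] := complement_split ee nn' en' ne' ll' el' le' ln'.
set k' := _ - _ => kk' [nk' kn'] [ek' ke'] lk' eqk'.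
(* Cutting [r] and [r'] down to [k] and [k'] keeps them inverse: the error term passes through
   [l' * r' = y = y * l], and [l * k = 0]; the other composite is symmetric. *)
have half j j' m m' p p' s s' z : s * (e - m') = s -> s * s' = e - m ->
    m' * m' = m' -> e * m' = m' -> p' * s' = z -> z * p = z -> p * j = 0 ->
    j * j = j -> e * j = j -> m * j = 0 ->
    j' = e - m' - (p' - m' * p') -> j' * j' = j' ->
    j * s * j' * (j' * s' * j) = j.
  move=> sm' ss' mm' em' p's' zp pj jj ej mj j'E jj'.
  have sm0 : s * m' = 0 by rewrite -sm' -mulrA mulrBl em' mm' subrr mulr0.
  have sj' : s * j' = s - s * p'.
    by rewrite j'E mulrBr sm' mulrBr mulrA sm0 mul0r subr0.
  rewrite !mulrA -(mulrA _ j' j') jj' -(mulrA j) sj' mulrBr !mulrBl.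
  rewrite -!mulrA (mulrA s s') ss' (mulrA p') p's' -zp -mulrA pj !mulr0 subr0.
  by rewrite mulrBl ej mj subr0.
exists n, k, n', k'; split=> //.
exists (k * r * k'), (k' * r' * k); split.
  by apply: (half _ _ n n' l l' r r' y).
by apply: (half _ _ n' n l' l r' r x).
Qed.

End Ideals.

(** * Cyclic projective modules as idempotents *)

Section Representation.
Variable A : pzRingType.
Implicit Types (M N D K L : lmodType A) (e f l n : A).

(** [M] is identified with [Ae] by [i], and [p] is the matching retraction of [A] onto [M]. *)
Definition represents M e :=
  exists (i : {linear M -> A^o}) (p : {linear A^o -> M}),
    cancel i p /\ forall a : A, i (p a) = a * e.

Lemma represents_idem M e : represents M e -> e * e = e.
Proof.
case=> i [p [iK ip]]; have e1 : i (p 1) = e by rewrite ip mul1r.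
by rewrite -(ip e) -{1}e1 iK e1.
Qed.

Lemma exists_represents e : e * e = e -> exists M, represents M e.
Proof.
move=> ee; have [x|M [i [p [iK ip]]]] := @split_idempotent _ _ (mul_on_right e).
  by rewrite /= /mul_on_right -mulrA ee.
by exists M, i, p.
Qed.

Lemma represents_iso M N e f :
  represents M e -> represents N f -> idem_equiv e f -> M =~ N.
Proof.
move=> Me Nf /(idem_equiv_corner (represents_idem Me) (represents_idem Nf)).
move=> [x [y [xy yx [_ xf] [_ ye]]]].
case: Me Nf => [i [p [iK ip]]] [j [q [jK jq]]].
apply: (@mod_isoI _ _ _ (q \o mul_on_right x \o i) (p \o mul_on_right y \o j)).
  move=> u /=; apply: (can_inj iK).
  rewrite ip jq /mul_on_right -!mulrA (mulrA x) xf (mulrA x) xy.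
  by rewrite mulrA -!ip !iK.
move=> u /=; apply: (can_inj jK).
by rewrite jq ip /mul_on_right -!mulrA (mulrA y) ye (mulrA y) yx mulrA -!jq !jK.
Qed.

Lemma represents_dsum M N e f : represents M e -> represents N f ->
  e * f = 0 -> f * e = 0 -> represents (dsum M N) (e + f).
Proof.
move=> [i [p [iK ip]]] [j [q [jK jq]]] ef fe.
exists (dcopair i j), (dpair p q); split=> [[u v]|a]; last first.
  by rewrite /= ip jq mulrDr.
have pj : p (j v) = 0.
  by apply: (can_inj iK); rewrite linear0 ip -[v]jK jq -mulrA fe mulr0.
have qi : q (i u) = 0.
  by apply: (can_inj jK); rewrite linear0 jq -[u]iK ip -mulrA ef mulr0.
by congr pair; rewrite /= linearD /= ?iK ?jK ?pj ?qi ?addr0 ?add0r.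
Qed.

Lemma summand_represents D : summand D A^o -> exists e, represents D e.
Proof.
case=> X /mod_isoE[f [g [fK gK]]].
pose i := f \o @dinl _ D X; pose p := @dfst _ D X \o g.
exists (i (p 1)), i, p; split=> [u|a]; first by rewrite /i /p /= fK.
exact: (linear_regularE (i \o p)).
Qed.

(** The projections of [D] onto [K] and [L], carried to [A] by [i] and [p], are right
    multiplications by two elements with sum [e]; [l] is the image of 1 under the second. *)
Lemma represents_dsum_inv D K L e : represents D e -> dsum K L =~ D ->
  exists l, [/\ represents K (e - l), represents L l,
                e * l = l & l * e = l].
Proof.
move=> [i [p [iK ip]]] /mod_isoE[f [g [fK gK]]].
pose iK' := i \o f \o @dinl _ K L; pose pK := @dfst _ K L \o g \o p.
pose iL := i \o f \o @dinr _ K L; pose pL := @dsnd _ K L \o g \o p.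
have lE a : iL (pL a) = a * iL (pL 1) := linear_regularE (iL \o pL) a.
have kE a : iK' (pK a) = a * iK' (pK 1) := linear_regularE (iK' \o pK) a.
have e1 : i (p 1) = e by rewrite ip mul1r.
have kl : iK' (pK 1) + iL (pL 1) = e.
  by rewrite -e1 -[p 1]gK [in RHS](dsum_eta f) linearD.
exists (iL (pL 1)); rewrite -[e in e - _]kl addrK; split.
- exists iK', pK; split=> // u; rewrite /iK' /pK /=.
  by rewrite iK fK.
- exists iL, pL; split=> // u; rewrite /iL /pL /=.
  by rewrite iK fK.
- by rewrite -lE /pL /= -e1 iK.
- by rewrite -ip /iL /= iK.
Qed.

Lemma represents_equiv L l l' :
  represents L l -> represents L l' -> idem_equiv l l'.
Proof.
move=> [i [p [iK ip]]] [j [q [jK jq]]].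
exists (j (p 1)), (i (q 1)); split.
  by rewrite -[LHS](linear_regularE (i \o q)) /= jK ip mul1r.
by rewrite -[LHS](linear_regularE (j \o p)) /= iK jq mul1r.
Qed.

Lemma absorbs_dsum D N e n :
  represents D e -> represents N n -> absorbs e n -> dsum D N =~ D.
Proof.
move=> De Nn [f [g [[efg ff gg fg gf] ef gn]]].
have [P Pf] := exists_represents ff; have [Q Qg] := exists_represents gg.
have DPQ : D =~ dsum P Q.
  apply: (represents_iso De (represents_dsum Pf Qg fg gf)).
  by rewrite -efg; exists e, e; rewrite (represents_idem De).
rewrite [X in _ =~ X]DPQ -(represents_iso Qg Nn gn).
by rewrite (represents_iso De Pf ef).
Qed.

Hypothesis regA : von_neumann_regular A.
Hypothesis injA : pseudo_injective A^o.

Lemma absorption_regular : absorption A.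
Proof.
move=> D K K' L /summand_represents[e De] KL K'L.
have ee := represents_idem De.
have [l [Kl Ll el le]] := represents_dsum_inv De KL.
have [l' [K'l Ll' el' le']] := represents_dsum_inv De K'L.
have [n [k [n' [k' [[nn kk nk kn] [nn' kk' nk' kn'] [ek ek'] kk0 [an an']]]]]] :=
  complement_absorption regA (partial_iso_mulr injA) ee (represents_idem Ll)
    el le (represents_idem Ll') el' le' (represents_equiv Ll Ll').
have [N Nn] := exists_represents nn; have [P Pk] := exists_represents kk.
have [N' Nn'] := exists_represents nn'; have [P' Pk'] := exists_represents kk'.
exists P, N, N'; split.
- by rewrite (represents_iso Kl (represents_dsum Nn Pk nk kn) ek) dsumC.
- rewrite (represents_iso K'l (represents_dsum Nn' Pk' nk' kn') ek') dsumC.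
  by rewrite (represents_iso Pk Pk' kk0).
- exact: absorbs_dsum De Nn an.
- exact: absorbs_dsum De Nn' an'.
Qed.

End Representation.

Theorem proposition2p7 (R : pzRingType) :
  von_neumann_regular R ->
  pseudo_injective (right_regular_module R) ->
  separative R.
Proof.
move=> regR injR M N fgM projM fgN projN MN MM.
have regRc : von_neumann_regular R^c.
  by move=> a; have [b ab] := regR a; exists b; rewrite {1}ab -mulrA.
apply: (separative_of_absorption regRc (absorption_regular regRc injR)) => //;
exact: fg_projectiveP.
Qed.
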